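(* Let $\ell$ be a prime number. Then there exists a finite connected vertex-transitive $3$-valent flexible graph $\Gamma_\ell$ of girth $2\ell$ such that $$|V\Gamma_\ell| \le 16 \cdot N(3,2\ell),$$ where $V\Gamma_\ell$ is the vertex set of $\Gamma_\ell$ and $N(3,2\ell)$ is the order of the largest $3$-generated finite group of exponent $2\ell$.
   Context: Graphs are simple and undirected. A graph is $3$-valent if every vertex has exactly three neighbours, and vertex-transitive if its automorphism group acts transitively on its vertices. The girth of a graph is the length of its shortest cycle. A connected vertex-transitive $3$-valent graph $\Gamma$ is called flexible if $\mathrm{Aut}(\Gamma)$ has exactly two orbits on the edge set of $\Gamma$ and the stabiliser in $\mathrm{Aut}(\Gamma)$ of every vertex has order at least $4$. A group is $3$-generated if it can be generated by three elements. *)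

(* Defs.v *)
From mathcomp Require Import all_boot all_fingroup all_solvable.

Set Implicit Arguments.
Unset Strict Implicit.
Unset Printing Implicit Defensive.

Local Open Scope group_scope.

Record sgraph := SGraph {
  vertex :> finType;
  adj : rel vertex;
  adj_sym : symmetric adj;
  adj_irrefl : irreflexive adj }.

Section Graphs.

Variable G : sgraph.

Definition connected_graph : bool :=
  (0 < #|G|)%N && [forall x : G, forall y : G, connect (@adj G) x y].

Definition three_valent : bool :=
  [forall x : G, #|[set y : G | adj x y]| == 3].

Definition edges : {set {set G}} :=
  [set E | [exists x : G, exists y : G, adj x y && (E == [set x; y])]].

Definition gaut : {set {perm G}} :=
  [set s : {perm G} | [forall x : G, forall y : G, adj (s x) (s y) == adj x y]].

Lemma gaut_group_set : group_set gaut.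
Proof.
apply/group_setP; split=> [|s t].
  by rewrite inE; apply/'forall_forallP=> x y; rewrite !perm1.
rewrite !inE => /'forall_'forall_eqP adj_s /'forall_'forall_eqP adj_t.
by apply/'forall_'forall_eqP=> x y; rewrite !permM adj_t adj_s.
Qed.

Canonical gaut_group := Group gaut_group_set.

Definition vertex_transitive : bool := [transitive gaut, on [set: G] | 'P].

(* Permutations act on edges, which are two-element sets of vertices, through
   the action ['P^*] on sets. *)
Definition flexible : bool :=
  (#|orbit ('P^*) gaut @: edges| == 2) && [forall x : G, 4 <= #|'C_gaut[x | 'P]|].

(* [ucycle] accepts closed walks of length at most 2, which are not cycles of a
   simple graph; hence the condition on the size. *)
Definition graph_cycle (c : seq G) : Prop := ucycle (@adj G) c /\ (3 <= size c)%N.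

Definition has_girth (g : nat) : Prop :=
  (exists c, graph_cycle c /\ size c = g) /\
  (forall c, graph_cycle c -> (g <= size c)%N).

End Graphs.

(* The generators need not be distinct. *)
Definition generated_by_n (d : nat) (gT : finGroupType) (H : {group gT}) : Prop :=
  exists s : d.-tuple gT, <<[set x in s]>> = H.

Definition finite_group_order (d e N : nat) : Prop :=
  exists (gT : finGroupType) (H : {group gT}),
    [/\ generated_by_n d H, exponent H = e & #|H| = N].

(* [largest_order d e N] says that N is the order of the largest d-generated
   finite group of exponent e. Such an N is unique when it exists; its existence
   is the solution of the restricted Burnside problem. *)
Definition largest_order (d e N : nat) : Prop :=
  finite_group_order d e N /\
  (forall M, finite_group_order d e M -> (M <= N)%N).

(* Main.v *)
Require Import Defs.
From mathcomp Require Import all_boot all_fingroup all_algebra cyclic abelian zify.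

Set Implicit Arguments.
Unset Strict Implicit.
Unset Printing Implicit Defensive.

(** Flexible 3-valent graphs come from groups N generated by four involutions
    z i b (i, b booleans).  The vertices are the pairs (g, i) with g in N;
    (g, i) is joined to (g * z i false, i) and (g * z i true, i), and, by a
    matching edge, to (g, ~~ i).  If the group N has automorphisms exchanging
    z i false and z i true for one i at a time, and one exchanging the two
    pairs, then they act on the graph together with the left translations: the
    graph is vertex-transitive, its edges fall into at most two orbits, matching
    edges and the others, and the two automorphisms of the first kind generate
    at least four elements fixing (1, false).

    Non-matching edges form cycles whose length is the order of the dihedral
    group D_i generated by z i false and z i true, so D_i is taken of order
    2 * l.  A cycle of length at most 2 * l using matching edges visits the two
    sides alternately; it spells a relation a1 b1 a2 b2 .. = 1 between
    nontrivial elements of D_false and D_true.  The number of factors is even,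
    and at most l because each of them costs at least two edges, hence at most
    2 * (l./2).  When N has no such relation [free_quadruple], the girth is 2 * l and matching edges are on no
    cycle of that length, so that there are exactly two orbits on edges.

    For l odd, N is the image of the free product of D_false and D_true in the
    permutations of its reduced words with at most m = l./2 syllables, where a
    letter acts as in van der Waerden's proof of the normal form theorem, and
    fixes the words that it would make too long.  A product of 2 * m syllables
    is 1 only if its first half and the inverse of its second half act in the
    same way; on the empty word each half writes itself down, and these words
    differ in their bottom letter.  There are at most 2 * (2 * l) ^ m words, so
    the order of N is at most the factorial of that number.

    The comparison with the largest 3-generated group of exponent 2 * l does not
    relate that group to N: it only says that the group is much larger.  It has
    at least 2 ^ (l ^ l) elements because of a lamplighter group
    [lamp_group], a wreath product of the group of order 2 with a 2-generated
    group of exponent l acting transitively on l ^ l points.  For l = 2 this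
    comparison fails and N is an elementary abelian group of order 16. *)

Lemma gen_ind (gT : finGroupType) (A : {set gT}) (P : gT -> Prop) : P 1%g ->
  (forall x a, P x -> a \in A -> P (x * a)%g) -> forall x, x \in <<A>>%g -> P x.
Proof.
move=> P1 PM x /gen_prodgP[n [c cA ->]].
elim: n c cA => [|n IHn] c cA; first by rewrite big_ord0.
by rewrite big_ord_recr /=; apply: PM => //; apply: IHn.
Qed.

(** * Products of alternating words in four involutions *)

Section Words.

Variables (gT : finGroupType) (z : bool -> bool -> gT).
Implicit Types (i b : bool) (k : nat) (s : seq (bool * nat)).

Fixpoint altword i b k : gT :=
  if k is k'.+1 then (z i b * altword i (~~ b) k')%g else 1%g.

(** Syllables alternate between the two sides, so that only the side i of the
    first one is recorded; the pair (b, k) stands for an alternating word of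
    length k beginning with the letter b. *)
Fixpoint syl_eval i s : gT :=
  if s is (b, k) :: s' then (altword i b k * syl_eval (~~ i) s')%g else 1%g.

Definition proper_syl l s := all (fun x => 0 < x.2 < 2 * l) s.

Lemma altwordD i b m n :
  altword i b (m + n) = (altword i b m * altword i (b (+) odd m) n)%g.
Proof.
elim: m b => [|m IHm] b; first by rewrite addbF mul1g.
by rewrite addSn /= IHm mulgA; case: b; case: (odd m).
Qed.

Lemma altwordSr i b k :
  altword i b k.+1 = (altword i b k * z i (b (+) odd k))%g.
Proof. by rewrite -addn1 altwordD /= mulg1. Qed.

Lemma syl_eval_cat i s1 s2 :
  syl_eval i (s1 ++ s2) = (syl_eval i s1 * syl_eval (i (+) odd (size s1)) s2)%g.
Proof.
elim: s1 i => [|[b k] s1 IHs] i /=; first by rewrite addbF mul1g.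
by rewrite IHs mulgA; case: i; case: (odd _).
Qed.

(** Up to 2 * l./2 syllables, the four elements multiply as in the free product
    of two dihedral groups of order 2 * l.  Syllable length is what matters,
    because a graph cycle of length at most 2 * l crosses at most l matching
    edges, and an even number of them. *)
Record free_quadruple (l : nat) : Prop := FreeQuadruple {
  quad_inv : forall i b, (z i b * z i b = 1)%g;
  quad_rel : forall i b, altword i b (2 * l) = 1%g;
  quad_free : forall i s, proper_syl l s -> 0 < size s <= 2 * l./2 ->
                syl_eval i s != 1%g }.

(** The flips r and the swap t induce on the four generators the dihedral group
    of order 8 that preserves the partition into two pairs. *)
Record dihedral_symmetry (r : bool -> gT -> gT) (t : gT -> gT) : Prop :=
  DihedralSymmetry {
  symr_morph : forall i, {morph r i : x y / (x * y)%g};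
  symr_inv : forall i, involutive (r i);
  symr_gen : forall i j b, r i (z j b) = z j (b (+) (i == j));
  symt_morph : {morph t : x y / (x * y)%g};
  symt_inv : involutive t;
  symt_gen : forall i b, t (z i b) = z (~~ i) b }.

Lemma altword_inv i b k : (forall i b, z i b * z i b = 1)%g ->
  ((altword i b k)^-1 = altword i (b (+) ~~ odd k) k)%g.
Proof.
move=> zK; elim: k => [|k IHk]; first by rewrite invg1.
rewrite altwordSr invMg IHk /=; congr (_ * altword _ _ _)%g; last first.
  by case: {IHk} b; case: (odd k).
apply/eqP; rewrite eq_invg_mul; apply/eqP; case: {IHk} b; case: (odd k) => /=;
 by rewrite zK.
Qed.

(** The group element spelled by a walk: Some b is a step along a generator, and
    None a matching edge, which changes sides without moving in the group. *)
Fixpoint label_eval i (L : seq (option bool)) : gT :=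
  match L with
  | [::] => 1%g
  | None :: L' => label_eval (~~ i) L'
  | Some b :: L' => (z i b * label_eval i L')%g
  end.

(** Maximal runs of generators in a walk without backtracking become syllables.
    Every run but possibly the first is preceded by a matching edge, which is
    why each syllable uses two steps.  The last clause says which generator
    begins the first run, so that the induction can lengthen it. *)
Lemma label_syl l i (a : option bool) (L : seq (option bool)) :
    sorted (fun x y => x != y) (a :: L) ->
    last a L != None -> size L < (2 * l).-1 ->
  exists2 s, proper_syl l s &
    [/\ label_eval i (a :: L) = syl_eval (if a is None then ~~ i else i) s,
        size s = count_mem None (a :: L) + (a != None),
        2 * size s <= size (a :: L) + (a != None) &
        if a is Some b then exists k s', s = (b, k) :: s' /\ 0 < k <= size (a :: L)
        else True].
Proof.
elim: L a i => [|a' L IHL] a i /=.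
  case: a => // b _ _ lt_l.
  exists [:: (b, 1)]; first by rewrite /proper_syl /=; lia.
  by rewrite /= !mulg1; split=> //; exists 1, [::].
case/andP=> neq_a sortL lastL ltL.
case: a neq_a => [b|]; last first.
  case: a' sortL lastL => [b|//] sortL lastL _.
  have [|s sP /= [eqs sz_s le_s _]] := IHL (Some b) (~~ i) sortL lastL; first lia.
  by exists s => //; split=> //=; lia.
case: a' sortL lastL => [b'|] sortL lastL neq_a.
  have [|s sP /= [eqs sz_s le_s [k [s' [def_s k_gt]]]]] := IHL (Some b') i sortL lastL.
    by lia.
  have def_b' : b' = ~~ b by case: b b' neq_a {sortL lastL sz_s le_s eqs def_s} => [] [].
  exists ((b, k.+1) :: s').
    move: sP; rewrite def_s /proper_syl /= => /andP[_ ->].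
    by rewrite andbT; move: ltL => /=; lia.
  rewrite eqs def_s /= def_b' mulgA; split=> //; try by move: sz_s le_s; rewrite def_s /=; lia.
  by exists k.+1, s'; split=> //=; lia.
have [|s sP /= [eqs sz_s le_s _]] := IHL None i sortL lastL; first lia.
exists ((b, 1) :: s); first by apply/andP; split=> //=; lia.
rewrite eqs /= mulg1; split=> //=; try lia.
by exists 1, s.
Qed.

End Words.

(** * The graph of a quadruple of involutions *)

Section Graph.

Variables (l : nat) (gT : finGroupType) (z : bool -> bool -> gT).
Variables (r : bool -> gT -> gT) (t : gT -> gT).
Hypotheses (l_gt1 : 1 < l) (Z : free_quadruple z l).
Hypothesis S : dihedral_symmetry z r t.
Hypothesis genZ : <<[set z p.1 p.2 | p : bool * bool]>>%g = [set: gT].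

Local Notation V := (gT * bool)%type.

Lemma altword_neq1 i b k : 0 < k < 2 * l -> altword z i b k != 1%g.
Proof.
move=> k_bd; have /= := quad_free Z i (s := [:: (b, k)]); rewrite mulg1.
by apply; [rewrite /proper_syl /= k_bd | lia].
Qed.

Lemma z_neq1 i b : z i b != 1%g.
Proof. by have := @altword_neq1 i b 1; rewrite /= mulg1; apply; lia. Qed.

Lemma z_inj i : injective (z i).
Proof.
suffices neqz b : z i b != z i (~~ b).
  move=> [] [] // eqz; first by have := neqz true; rewrite eqz eqxx.
  by have := neqz false; rewrite eqz eqxx.
have lt2 : 0 < 2 < 2 * l by lia.
apply: contraNneq (altword_neq1 i b lt2) => /= <-.
by rewrite mulg1 (quad_inv Z).
Qed.

Definition step (u : V) (a : option bool) : V :=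
  if a is Some b then ((u.1 * z u.2 b)%g, u.2) else (u.1, ~~ u.2).

Lemma stepK a : involutive (step^~ a).
Proof.
move=> [g i]; case: a => [b|] /=; last by rewrite /step /= negbK.
by rewrite /step /= -mulgA (quad_inv Z) mulg1.
Qed.

Lemma step_neq u a : step u a != u.
Proof.
case: u a => g i [b|]; rewrite /step xpair_eqE /=; last by case: i; rewrite andbF.
by rewrite eqxx andbT eq_sym eq_mulVg1 mulKg z_neq1.
Qed.

Lemma step_inj u : injective (step u).
Proof.
case: u => g i [b|] [b'|] //=; rewrite /step /= => [[]].
- by move/mulgI/z_inj->.
- by case: i.
- by case: i.
Qed.

Definition step_adj (u v : V) := [exists a, v == step u a].

Lemma step_adjP u v : reflect (exists a, v = step u a) (step_adj u v).
Proof. exact: 'exists_eqP. Qed.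

Lemma step_adj_sym : symmetric step_adj.
Proof.
suffices adjW u v : step_adj u v -> step_adj v u by move=> u v; apply/idP/idP; apply: adjW.
by case/step_adjP=> a ->; apply/step_adjP; exists a; rewrite stepK.
Qed.

Lemma step_adj_irrefl : irreflexive step_adj.
Proof.
move=> u; apply/step_adjP=> -[a def_u].
by have := step_neq u a; rewrite -def_u eqxx.
Qed.

Definition quad_graph : sgraph := SGraph step_adj_sym step_adj_irrefl.

Lemma adj_step (u : quad_graph) a : adj u (step u a).
Proof. by apply/step_adjP; exists a. Qed.

Lemma card_quad_graph : #|quad_graph| = 2 * #|gT|.
Proof. by rewrite card_prod card_bool mulnC. Qed.

Lemma quad_graph_three_valent : three_valent quad_graph.
Proof.
apply/forallP=> u; apply/eqP.
transitivity #|[set step u a | a : option bool]|.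
  apply: eq_card => v; rewrite inE; apply/step_adjP/imsetP.
    by case=> a ->; exists a.
  by case=> a _ ->; exists a.
by rewrite card_imset ?card_option ?card_bool //; apply: step_inj.
Qed.

Lemma quad_graph_connected : connected_graph quad_graph.
Proof.
have base g i : connect (@adj quad_graph) (1%g, false) (g, i).
  suffices conn_g : connect (@adj quad_graph) (1%g, false) (g, false).
    case: i => //; apply: connect_trans conn_g (connect1 _).
    exact: (adj_step (g, false) None).
  have: g \in <<[set z p.1 p.2 | p : bool * bool]>>%g by rewrite genZ inE.
  move: g; apply: gen_ind => // x _ conn_x /imsetP[[j b] _ ->] /=.
  apply: connect_trans conn_x _.
  case: j; last exact: connect1 (adj_step (x, false) (Some b)).
  apply: connect_trans (connect1 (adj_step (x, false) None)) _.
  apply: connect_trans (connect1 (adj_step (x, true) (Some b))) _.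
  exact: connect1 (adj_step ((x * z true b)%g, true) None).
apply/andP; split; first by apply/card_gt0P; exists (1%g, false).
apply/'forall_forallP=> -[g i] [h j].
apply: connect_trans (base h j).
by rewrite (sym_connect_sym (@adj_sym quad_graph)).
Qed.

Definition left_map h (u : V) : V := ((h * u.1)%g, u.2).
Definition flip_map j (u : V) : V := (r j u.1, u.2).
Definition swap_map (u : V) : V := (t u.1, ~~ u.2).

Lemma left_map_inj h : injective (left_map h).
Proof. by move=> [g i] [g' i'] [/mulgI-> ->]. Qed.

Lemma flip_map_inj j : injective (flip_map j).
Proof. by move=> [g i] [g' i'] [/(can_inj (symr_inv S j))-> ->]. Qed.

Lemma swap_map_inj : injective swap_map.
Proof. by move=> [g i] [g' i'] [/(can_inj (symt_inv S))-> /negb_inj->]. Qed.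

Definition left_aut h : {perm quad_graph} := perm (@left_map_inj h).
Definition flip_aut j : {perm quad_graph} := perm (@flip_map_inj j).
Definition swap_aut : {perm quad_graph} := perm swap_map_inj.

(** Mapping adjacent pairs to adjacent pairs is enough: by finiteness, the
    induced injection on the set of adjacent pairs is onto. *)
Lemma gaut_step (s : {perm quad_graph}) :
    (forall u a, exists a', s (step u a) = step (s u) a') -> s \in gaut quad_graph.
Proof.
move=> s_step; pose f (p : V * V) := (s p.1, s p.2).
have f_inj : injective f by move=> [u v] [u' v'] [/perm_inj-> /perm_inj->].
pose E := [set p : V * V | step_adj p.1 p.2].
have sub_E : f @: E \subset E.
  apply/subsetP=> _ /imsetP[[u v] uvE ->]; move: uvE; rewrite !inE /=.
  by case/step_adjP=> a ->; have [a' ->] := s_step u a; apply: adj_step.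
have fE : f @: E = E by apply/eqP; rewrite eqEcard sub_E card_imset ?leqnn.
rewrite inE; apply/'forall_'forall_eqP=> u v.
by have := mem_imset E (u, v) f_inj; rewrite fE !inE.
Qed.

Lemma left_autP h : left_aut h \in gaut quad_graph.
Proof.
apply: gaut_step => -[g i] a; exists a; rewrite !permE /left_map /step /=.
by case: a => [b|] //=; rewrite mulgA.
Qed.

Lemma flip_autP j : flip_aut j \in gaut quad_graph.
Proof.
apply: gaut_step => -[g i] [b|]; rewrite !permE /flip_map /step /=; last by exists None.
by exists (Some (b (+) (j == i))); rewrite /= (symr_morph S) (symr_gen S).
Qed.

Lemma swap_autP : swap_aut \in gaut quad_graph.
Proof.
apply: gaut_step => -[g i] a; rewrite !permE /swap_map /step /=; exists a.
by case: a => [b|] //=; rewrite (symt_morph S) (symt_gen S).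
Qed.

Lemma symt1 : t 1%g = 1%g.
Proof. by apply: (mulgI (t 1%g)); rewrite -(symt_morph S) !mulg1. Qed.

Lemma symr1 j : r j 1%g = 1%g.
Proof. by apply: (mulgI (r j 1%g)); rewrite -(symr_morph S) !mulg1. Qed.

Lemma base_orbit (u : quad_graph) : u \in orbit 'P (gaut quad_graph) ((1%g, false) : quad_graph).
Proof.
case: u => g i; apply/orbitP.
case: i; last first.
  by exists (left_aut g); rewrite ?left_autP //= /aperm permE /left_map /= mulg1.
exists (swap_aut * left_aut g)%g; first by rewrite groupM ?left_autP ?swap_autP.
by rewrite /= /aperm permM !permE /= /left_map /= symt1 mulg1.
Qed.

Lemma quad_graph_vertex_transitive : vertex_transitive quad_graph.
Proof.
apply/imsetP; exists ((1%g, false) : quad_graph); rewrite ?inE //.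
by apply/eqP; rewrite eqEsubset subsetT andbT; apply/subsetP=> u _; apply: base_orbit.
Qed.

(** The two flips fix (1, false) and act independently on the neighbours
    (z i false, i) of (1, i), so that their four products are distinct. *)
Lemma stab_ge4 (u : quad_graph) : 4 <= #|'C_(gaut quad_graph)[u | 'P]|%g.
Proof.
suffices base : 4 <= #|'C_(gaut quad_graph)[((1%g, false) : quad_graph) | 'P]|%g.
  have orbT (v : quad_graph) : orbit 'P (gaut quad_graph) v = [set: quad_graph].
    by apply: (atransP quad_graph_vertex_transitive); rewrite inE.
  have := card_orbit_stab 'P [group of gaut quad_graph] u.
  rewrite -(card_orbit_stab 'P [group of gaut quad_graph] ((1%g, false) : quad_graph)) !orbT.
  move/eqP; rewrite eqn_pmul2l; first by move/eqP->.
  by apply/card_gt0P; exists u; rewrite inE.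
pose f (c : bool * bool) : {perm quad_graph} :=
  ((if c.1 then flip_aut false else 1) * (if c.2 then flip_aut true else 1))%g.
have f_im (c : bool * bool) (i : bool) :
  f c (z i false, i) = (z i (if i then c.2 else c.1), i).
  by case: c i => [[] []] []; rewrite /f /= permM ?perm1 ?permE /= /flip_map /=
    ?(symr_gen S) ?(symr_gen S) /= ?perm1 ?permE.
have f_inj : injective f.
  move=> [c d] [c' d'] eq_f.
  have := f_im (c, d) false; rewrite eq_f f_im => -[/= /z_inj->].
  by have := f_im (c, d) true; rewrite eq_f f_im => -[/= /z_inj->].
have <- : #|[set f c | c : bool * bool]| = 4.
  by rewrite card_imset // card_prod card_bool.
apply/subset_leq_card/subsetP=> _ /imsetP[[c d] _ ->].
rewrite inE groupM ?astab1P; try by case: ifP; rewrite ?group1 ?flip_autP.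
by apply/astab1P; case: c; case: d; rewrite /f /= /aperm permM ?perm1 ?permE /=
  /flip_map /= ?perm1 ?permE /= ?/flip_map /= ?symr1.
Qed.

Definition edge (u : quad_graph) a : {set quad_graph} := [set u; step u a].

Lemma edgesP (E : {set quad_graph}) :
  reflect (exists u a, E = edge u a) (E \in edges quad_graph).
Proof.
rewrite inE; apply: (iffP existsP) => [[u /existsP[v /andP[]]]|[u [a ->]]].
  by case/step_adjP=> a -> /eqP->; exists u, a.
by exists u; apply/existsP; exists (step u a); rewrite adj_step eqxx.
Qed.

Lemma setact_edge (s : {perm quad_graph}) (u v : quad_graph) :
  ('P^*)%act [set u; v] s = [set s u; s v].
Proof. by rewrite /= /setact imsetU1 imset_set1. Qed.

(** A flip adjusts the generator, then a swap the side, then a left translation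
    the group element. *)
Lemma edge_orbit u a : exists2 s : {perm quad_graph}, s \in gaut quad_graph &
  edge u a = ('P^*)%act (edge (1%g, false) (if a is None then None else Some false)) s.
Proof.
case: u => g i; case: a => [b|]; last first.
  have [s' aut_s' [im1 im2]] : exists2 s' : {perm quad_graph}, s' \in gaut quad_graph &
      s' (1%g, false) = (g, i) /\ s' (1%g, true) = (g, ~~ i).
    case: i; last by exists (left_aut g); rewrite ?left_autP // !permE /left_map /= mulg1.
    exists (swap_aut * left_aut g)%g; first by rewrite groupM ?left_autP ?swap_autP.
    by rewrite !permM !permE /= /left_map /= symt1 mulg1.
  by exists s' => //; rewrite setact_edge im1 im2.
pose s1 : {perm quad_graph} := if b then flip_aut false else 1%g.
pose s2 : {perm quad_graph} := if i then swap_aut else 1%g.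
exists (s1 * s2 * left_aut g)%g.
  rewrite !groupM ?left_autP //; first by rewrite /s1; case: (b); rewrite ?flip_autP.
  by rewrite /s2; case: (i); rewrite ?swap_autP.
have [im1 im1'] : s1 (1%g, false) = (1%g, false) /\ s1 (z false false, false) = (z false b, false).
  by rewrite /s1; case: (b); rewrite ?perm1 // !permE /flip_map /= symr1 (symr_gen S).
have im2 x : s2 (x, false) = ((if i then t x else x), i).
  by rewrite /s2; case: (i); rewrite ?perm1 // !permE.
rewrite setact_edge !permM /= mul1g im1 im1' !im2 !permE /left_map /edge /step /=.
by case: (i); rewrite ?symt1 ?(symt_gen S) mulg1.
Qed.

Definition label (u v : V) : option bool :=
  if u.2 == v.2 then Some (v.1 != (u.1 * z u.2 false)%g) else None.

Lemma label_step u a : label u (step u a) = a.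
Proof.
case: a => [b|]; rewrite /label /=; last by case: u.2.
rewrite eqxx; congr Some; rewrite (inj_eq (mulgI _)) (inj_eq (@z_inj _)).
by case: b.
Qed.

Lemma step_label (u v : quad_graph) : adj u v -> v = step u (label u v).
Proof. by case/step_adjP=> a ->; rewrite label_step. Qed.

(** Walks without backtracking, rather than paths with distinct vertices, so that
    the closed walk around a cycle qualifies. *)
Fixpoint reduced_walk (u : V) p :=
  if p is v :: p' then (if p' is w :: _ then u != w else true) && reduced_walk v p'
  else true.

Lemma uniq_reduced_walk u p : uniq (u :: p) -> reduced_walk u p.
Proof.
elim: p u => //= v p IHp u /and3P[]; rewrite inE negb_or => /andP[_ up] vp up'.
rewrite IHp /= ?vp // andbT; case: p up {IHp vp up'} => //= w p.
by rewrite inE negb_or => /andP[].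
Qed.

Lemma reduced_walk_rcons u p v w :
  reduced_walk u (rcons (rcons p v) w) =
  reduced_walk u (rcons p v) && (last u p != w).
Proof.
elim: p u => [|x p IHp] u /=; first by rewrite !andbT.
by rewrite IHp andbA; case: p {IHp}.
Qed.

(** Two equal consecutive labels would undo each other, since a step with a
    given label is an involution on vertices. *)
Lemma walk_labels (u : quad_graph) p : path (@adj quad_graph) u p -> reduced_walk u p ->
  let L := pairmap label u p in
  sorted (fun x y => x != y) L /\
  last u p = ((u.1 * label_eval z u.2 L)%g, u.2 (+) odd (count_mem None L)).
Proof.
elim: p u => [|v p IHp] u /=; first by rewrite mulg1 addbF -surjective_pairing.
case/andP=> adj_uv path_p /andP[red_uv red_p].
have [sortL lastL] := IHp v path_p red_p; split.
  case: p path_p red_uv sortL {IHp red_p lastL} => //= w p /andP[adj_vw _] red_uv ->.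
  rewrite andbT; apply: contraNneq red_uv => eq_lab.
  by rewrite (step_label adj_vw) -eq_lab {1}(step_label adj_uv) stepK.
rewrite lastL (step_label adj_uv) label_step.
case: (label u v) => [b|] /=; rewrite ?mulgA ?add0n //.
by rewrite addbN addNb.
Qed.

Lemma walk_syl (u : quad_graph) p a L : path (@adj quad_graph) u p -> reduced_walk u p ->
    pairmap label u p = a :: L -> last a L != None -> size p < 2 * l ->
  exists2 s, proper_syl l s &
   [/\ (last u p).1 = (u.1 * syl_eval z (if a is None then ~~ u.2 else u.2) s)%g,
    (last u p).2 = u.2 (+) odd (size s) (+) (a != None),
    size s = count_mem None (a :: L) + (a != None) &
    2 * size s <= size p + (a != None)].
Proof.
move=> path_p red_p def_L last_L lt_p.
have [] := walk_labels path_p red_p; rewrite def_L => sortL lastp.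
have sz_p : size p = (size L).+1 by rewrite -(size_pairmap label u p) def_L.
have [|s sP [eq_s sz_s le_s _]] := @label_syl _ z l u.2 a L sortL last_L; first lia.
exists s => //; split=> //; last by rewrite sz_p.
  by rewrite lastp eq_s.
by rewrite lastp sz_s oddD /= -addbA; case: (a != None); rewrite /= ?addbF ?addbT ?addNb ?addbN ?negbK.
Qed.

(** Follow the cycle from w, just after its matching edge, back to v, just
    before it.  The walk begins and ends with generators and stays at the same
    group element, so it spells a relation; it ends on the other side, hence has
    an even number of syllables, and at most l of them if the cycle is not longer
    than 2 * l.  Evenness turns this bound into 2 * l./2 when l is odd. *)
Lemma matching_cycle (c : seq quad_graph) (v : quad_graph) : graph_cycle c -> v \in c ->
  next c v = step v None -> 2 * l < size c.
Proof.
move=> [/andP[cyc_c Uc] sz_c] v_c; case: (rot_to v_c) => n q def_c nx.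
rewrite -(next_rot n Uc) def_c in nx.
rewrite -(rot_cycle n) in cyc_c; rewrite -(rot_uniq n) in Uc; rewrite -(size_rot n) in sz_c *.
move: {c v_c} (rot n c) def_c cyc_c Uc sz_c nx => c ->.
case: q => [|w [|x q]] // cyc_c Uc _; rewrite /= eqxx => def_w.
rewrite ltnNge; apply/negP=> le_c.
have Uwc : uniq (w :: rcons (x :: q) v).
  by rewrite -rcons_cons rcons_uniq.
have path_w : path (@adj quad_graph) w (rcons (x :: q) v).
  by move: cyc_c => /= /andP[].
have red_w := uniq_reduced_walk Uwc.
have vw : v = step w None by rewrite def_w; apply: esym (stepK None v).
have hdL : label w x != None.
  apply: contraTneq Uc => lab.
  move: path_w => /= /andP[/step_label]; rewrite lab -vw => ->.
  by rewrite /= !inE eqxx /= orbT.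
have [] := @walk_syl w (rcons (x :: q) v) (label w x) (pairmap label x (rcons q v))
  path_w red_w erefl.
- rewrite -cats1 pairmap_cat /= cats1 last_rcons.
  apply: contraTneq Uwc => lab.
  move: path_w; rewrite rcons_path => /andP[_ /step_label /=].
  rewrite lab vw => /(can_inj (stepK None)) => def_y.
  have w_in : w \in x :: q by rewrite def_y mem_last.
  by rewrite -rcons_cons mem_rcons inE w_in orbT.
- by move: le_c => /=; rewrite size_rcons; lia.
move=> s sP; rewrite hdL last_rcons vw /= => -[eqg eqi sz_s le_s].
have even_s : ~~ odd (size s) by move: eqi; case: w.2; case: (odd _).
have: syl_eval z (if label w x is None then ~~ w.2 else w.2) s == 1%g.
  by rewrite -(inj_eq (mulgI w.1)) -eqg mulg1.
apply/negP/(quad_free Z) => //.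
by rewrite size_rcons /= in le_c le_s; lia.
Qed.

(** A cycle without matching edges is a single syllable equal to 1. *)
Lemma cycle_ge (c : seq quad_graph) : graph_cycle c -> 2 * l <= size c.
Proof.
move=> cyc_c; have [/existsP[v /andP[v_c /eqP nx]]|] :=
  boolP [exists v, (v \in c) && (next c v == step v None)].
  exact: ltnW (matching_cycle cyc_c v_c nx).
case: cyc_c => /andP[cyc_c Uc] sz_c noM.
rewrite leqNgt; apply/negP=> lt_c.
case: c sz_c Uc cyc_c noM lt_c => // v p sz_p Uc cyc_c noM lt_c.
have red_v : reduced_walk v (rcons p v).
  case/lastP: p sz_p Uc {cyc_c noM lt_c} => // p x sz_p Uc.
  rewrite reduced_walk_rcons uniq_reduced_walk //=.
  move: sz_p Uc; rewrite /= size_rcons.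
  case/lastP: p => // p y _; rewrite last_rcons.
  rewrite !mem_rcons !inE !mem_rcons !inE !negb_or => /andP[/and3P[_ neq_vy _] _].
  by rewrite eq_sym.
have noL : None \notin pairmap label v (rcons p v).
  apply: contra noM => /(nthP None)[j]; rewrite size_pairmap size_rcons => lt_j.
  rewrite (nth_pairmap v) ?size_rcons // => lab.
  pose u := nth v (v :: p) j; apply/existsP; exists u.
  have u_c : u \in v :: p by apply: mem_nth.
  rewrite u_c /=; have adj_u := next_cycle cyc_c u_c.
  suffices lab_u : label u (next (v :: p) u) = None.
    by apply/eqP; have := step_label adj_u; rewrite lab_u.
  rewrite -[RHS]lab {2}/u next_nth u_c index_uniq //.
  congr label; first by rewrite -rcons_cons nth_rcons /= lt_j.
  rewrite nth_rcons; case: (ltnP j (size p)) => // le_pj.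
  by rewrite nth_default // if_same.
have [a [L def_L]] : exists a L, pairmap label v (rcons p v) = a :: L.
  by case: (p) => [|x q]; rewrite /=; eexists; eexists.
have hd_a : a != None by move: noL; rewrite def_L inE negb_or eq_sym => /andP[].
have last_L : last a L != None.
  by apply: contraNneq noL => <-; rewrite def_L mem_last.
have [||s sP] := walk_syl _ red_v def_L last_L; first exact: cyc_c.
  by rewrite size_rcons.
rewrite last_rcons hd_a => -[eqg _].
have -> : count_mem None (a :: L) = 0 by apply/count_memPn; rewrite -def_L.
move=> sz_s _.
have: syl_eval z (if a is None then ~~ v.2 else v.2) s == 1%g.
  by rewrite -(inj_eq (mulgI v.1)) -eqg mulg1.
apply/negP/(quad_free Z) => //; rewrite sz_s; lia.
Qed.

(** The vertices on side false whose group element lies in the dihedral group of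
    that side, in cyclic order. *)
Definition rim k : quad_graph := (altword z false false k, false).

Lemma rim_adj k : adj (rim k) (rim k.+1).
Proof. by apply/step_adjP; exists (Some (odd k)); rewrite /step /rim altwordSr. Qed.

Definition rim_cycle := mkseq rim (2 * l).

Lemma rim_cycleP : graph_cycle rim_cycle.
Proof.
have path_rim j n : path (@adj quad_graph) (rim j) (map rim (iota j.+1 n)).
  by elim: n j => // n IHn j; apply/andP; split; [apply: rim_adj | apply: IHn].
split; last by rewrite size_mkseq; lia.
apply/andP; split.
  rewrite /rim_cycle; case def_n: (2 * l) => [|n]; first by lia.
  rewrite /mkseq /=.
  have rim_n : rim n.+1 = rim 0 by rewrite /rim -def_n (quad_rel Z).
  have def_iota : rcons (iota 1 n) n.+1 = iota 1 n.+1.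
    by rewrite -[in RHS](addn1 n) iotaD cats1.
  rewrite -[X in rcons _ X]rim_n -map_rcons def_iota; apply: path_rim.
apply/(uniqP (1%g, false)) => j k; rewrite !inE !size_mkseq => lt_j lt_k.
rewrite !nth_mkseq //.
wlog lt_jk : j k lt_j lt_k / j < k.
  move=> wlogP eq_jk; case: (ltngtP j k) => // cmp; first exact: wlogP eq_jk.
  by apply/esym; apply: wlogP (esym eq_jk).
case=> /eqP; rewrite -(subnKC (ltnW lt_jk)) altwordD -{1}[altword _ _ _ j]mulg1.
by rewrite (inj_eq (mulgI _)) eq_sym (negPf (altword_neq1 _ _ _)) //; lia.
Qed.

Lemma quad_graph_girth : has_girth quad_graph (2 * l).
Proof.
split; last exact: cycle_ge.
by exists rim_cycle; split; [apply: rim_cycleP | rewrite size_mkseq].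
Qed.

(** The edge from (1, false) along z false false is on a cycle of length 2 * l,
    and a matching edge is not. *)
Lemma edge_orbits_neq : edge (1%g, false) (Some false) \notin
  orbit ('P^*) (gaut quad_graph) (edge (1%g, false) None).
Proof.
apply/negP=> /orbitP[s s_aut /= eq_e].
rewrite setact_edge in eq_e.
have [n def_n] : exists n, 2 * l = n.+2 by exists (2 * l).-2; lia.
have [cyc_rim sz_rim] := rim_cycleP; have /andP[cyc Uc] := cyc_rim.
have rim0 : rim 0 = (1%g, false) by [].
have rim1 : rim 1 = (z false false, false) by rewrite /rim /= mulg1.
have adjV x y : adj ((s^-1)%g x) ((s^-1)%g y) = adj x y.
  have: (s^-1)%g \in gaut quad_graph by rewrite groupV.
  by rewrite inE => /'forall_'forall_eqP.
pose c := map (s^-1)%g rim_cycle.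
have cycP : graph_cycle c.
  split; last by rewrite size_map.
  rewrite /ucycle (map_inj_uniq perm_inj) Uc andbT.
  by rewrite cycle_map (eq_cycle (e' := @adj quad_graph)) // => x y; apply: adjV.
have nextc : next c ((s^-1)%g (rim 0)) = (s^-1)%g (rim 1).
  rewrite (next_map perm_inj) //; congr (_ _).
  by rewrite /rim_cycle def_n /mkseq /= eqxx.
have mem0 : (s^-1)%g (rim 0) \in c.
  by apply: map_f; rewrite /rim_cycle def_n /mkseq /= mem_head.
suffices def1 : (s^-1)%g (rim 1) = step ((s^-1)%g (rim 0)) None.
  rewrite def1 in nextc.
  have := matching_cycle cycP mem0 nextc.
  by rewrite size_map size_mkseq ltnn.
have im_in x : x \in edge (1%g, false) (Some false) -> (s^-1)%g x \in edge (1%g, false) None.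
  by rewrite -eq_e !inE => /orP[]/eqP->; rewrite permK eqxx ?orbT.
have in0 : (s^-1)%g (rim 0) \in edge (1%g, false) None.
  by apply: im_in; rewrite rim0 set21.
have in1 : (s^-1)%g (rim 1) \in edge (1%g, false) None.
  by apply: im_in; rewrite rim1 /edge /step /= mul1g set22.
have neq01 : (s^-1)%g (rim 0) != (s^-1)%g (rim 1).
  by rewrite (inj_eq perm_inj); apply: contraTneq (rim_adj 0) => ->; rewrite adj_irrefl.
by case/set2P: in0 neq01 => ->; case/set2P: in1 => ->; rewrite ?eqxx.
Qed.

Lemma quad_graph_flexible : flexible quad_graph.
Proof.
apply/andP; split; last by apply/forallP=> u; apply: stab_ge4.
pose base a := orbit ('P^*) (gaut quad_graph) (edge (1%g, false) a).
have -> : orbit ('P^*) (gaut quad_graph) @: edges quad_graph = [set base None; base (Some false)].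
  apply/setP=> O; apply/imsetP/set2P => [[E /edgesP[u [a ->]] ->]|].
    have [s s_aut ->] := edge_orbit u a.
    by case: a => [b|]; [right | left]; apply/orbit_eqP/mem_orbit.
  by case=> ->; eexists; rewrite // ; apply/edgesP; do 2!eexists.
rewrite cards2; suffices -> : base None != base (Some false) by [].
by apply: contraNneq edge_orbits_neq => eqb; rewrite -/(base None) eqb orbit_refl.
Qed.

End Graph.

(** * Passing to the subgroup generated by the quadruple *)

Section Subgroup.

Variables (l : nat) (gT : finGroupType) (z : bool -> bool -> gT).
Variables (r : bool -> gT -> gT) (t : gT -> gT).
Hypotheses (l_gt1 : 1 < l) (Z : free_quadruple z l).
Hypothesis S : dihedral_symmetry z r t.

Let N := <<[set z p.1 p.2 | p : bool * bool]>>%G.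
Let zN i b : subg_of N := subg N (z i b).

Lemma mem_quad i b : z i b \in N.
Proof. by apply: mem_gen; apply/imsetP; exists (i, b). Qed.

Lemma val_quad i b : sgval (zN i b) = z i b.
Proof. by rewrite subgK ?mem_quad. Qed.

Lemma val_altword i b k : sgval (altword zN i b k) = altword z i b k.
Proof. by elim: k b => //= k IHk b; rewrite -IHk -val_quad. Qed.

Lemma val_syl_eval i s : sgval (syl_eval zN i s) = syl_eval z i s.
Proof. by elim: s i => //= [[b k] s] IHs i; rewrite -IHs -val_altword. Qed.

Lemma subg_free_quadruple : free_quadruple zN l.
Proof.
split=> [i b|i b|i s s_ok sz_s].
- by apply: val_inj; rewrite /= !val_quad (quad_inv Z).
- by apply: val_inj; rewrite /= val_altword (quad_rel Z).
by apply: contraNneq (quad_free Z i s_ok sz_s) => eq1; rewrite -val_syl_eval eq1.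
Qed.

Lemma morph_gen (f : gT -> gT) : {morph f : x y / (x * y)%g} ->
  (forall i b, f (z i b) \in N) -> forall x, x \in N -> f x \in N.
Proof.
move=> fM fz; apply: gen_ind => [|x a fx /imsetP[p _ ->]].
  suffices -> : f 1%g = 1%g by apply: group1.
  by apply: (mulgI (f 1%g)); rewrite -fM !mulg1.
by rewrite fM groupM.
Qed.

Definition restrict (f : gT -> gT) (x : subg_of N) := subg N (f (sgval x)).

Lemma subg_symmetry :
  dihedral_symmetry zN (fun j => restrict (r j)) (restrict t).
Proof.
have rN j x : x \in N -> r j x \in N.
  by apply: morph_gen => [|i b]; [apply: symr_morph S _ | rewrite (symr_gen S) mem_quad].
have tN x : x \in N -> t x \in N.
  by apply: morph_gen => [|i b]; [apply: symt_morph S | rewrite (symt_gen S) mem_quad].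
have val_r j (x : subg_of N) : sgval (restrict (r j) x) = r j (sgval x).
  by rewrite subgK ?rN ?subgP.
have val_t (x : subg_of N) : sgval (restrict t x) = t (sgval x).
  by rewrite subgK ?tN ?subgP.
split.
- by move=> i x y; apply: val_inj; rewrite /= !val_r /= (symr_morph S).
- by move=> i x; apply: val_inj; rewrite /= !val_r (symr_inv S).
- by move=> i j b; apply: val_inj; rewrite /= val_r !val_quad (symr_gen S).
- by move=> x y; apply: val_inj; rewrite /= !val_t /= (symt_morph S).
- by move=> x; apply: val_inj; rewrite /= !val_t (symt_inv S).
by move=> i b; apply: val_inj; rewrite /= val_t !val_quad (symt_gen S).
Qed.

Lemma subg_gen : <<[set zN p.1 p.2 | p : bool * bool]>>%g = [set: subg_of N].
Proof.
apply/setP=> x; rewrite inE -(sgvalK x).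
set M := <<_>>%g.
suffices [_ ->] : sgval x \in N /\ subg N (sgval x) \in M by [].
move: (sgval x) (subgP x).
apply: gen_ind => [|y a [yN yM] /imsetP[p _ ->]].
  by rewrite group1 morph1 group1.
rewrite groupM ?mem_quad // subgM ?mem_quad //; split=> //.
by rewrite groupM //; apply: mem_gen; apply/imsetP; exists p.
Qed.

(** Connectedness requires the four involutions to generate, so the graph is
    built on the subgroup that they generate; its order is then at most twice
    that of any group in which the quadruple is found. *)
Theorem flexible_graph_of_quadruple : exists Gamma : sgraph,
  [/\ [/\ connected_graph Gamma, vertex_transitive Gamma, three_valent Gamma
        & flexible Gamma],
      has_girth Gamma (2 * l) & #|Gamma| <= 2 * #|gT|].
Proof.
exists (quad_graph l_gt1 subg_free_quadruple); split.
- split.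
  + exact: quad_graph_connected subg_gen.
  + exact: quad_graph_vertex_transitive subg_symmetry.
  + exact: quad_graph_three_valent.
  + exact: quad_graph_flexible subg_symmetry.
- exact: quad_graph_girth.
rewrite card_quad_graph leq_mul2l /= card_sub.
by apply: leq_trans (max_card _) _.
Qed.

End Subgroup.

(** * The action on short reduced words *)

Section FreeProductAction.

Import GRing.Theory.

Variables l m : nat.
Hypothesis l_gt1 : 1 < l.

Local Notation Z2l := 'Z_(2 * l).
Local Notation letter := (bool * Z2l)%type.
Implicit Types (i b : bool) (j : Z2l) (w : seq letter) (k : nat).

Let modulus : (Zp_trunc (2 * l)).+2 = 2 * l.
Proof. by apply: Zp_cast; lia. Qed.

Lemma odd_modulus n : odd (n %% (Zp_trunc (2 * l)).+2) = odd n.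
Proof. by rewrite odd_mod // modulus mul2n odd_double. Qed.

Lemma oddZD j j' : odd (j + j')%R = odd j (+) odd j'.
Proof. by rewrite /= odd_modulus oddD. Qed.

Lemma oddZ1 : odd (1%R : Z2l).
Proof. exact: (odd_modulus 1). Qed.

Lemma oddZN j : odd (- j)%R = odd j.
Proof.
by apply: (@addbI (odd j)); rewrite -oddZD addrN addbb.
Qed.

(** The dihedral group acts regularly on the integers mod 2 * l, seen as the
    vertices of a polygon whose edges are coloured by the two generators:
    generator b exchanges j and j + 1 when j has parity b.  The elements of a
    dihedral group are thus named by positions, with 0 for the identity, and
    [turn b k] is the action of an alternating word of length k. *)
Definition flip b j : Z2l := (if odd j == b then j + 1 else j - 1)%R.
Definition turn b k j : Z2l := (if odd j == b then j + k%:R else j - k%:R)%R.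

Lemma flipK b : involutive (flip b).
Proof.
move=> j; rewrite /flip; case: (eqVneq (odd j) b) => [eq_b|neq_b].
  by rewrite oddZD oddZ1 addbT eq_b; case: (b); rewrite /= addrK.
by rewrite oddZD oddZN oddZ1 addbT; case: (odd j) b neq_b => [] []; rewrite //= subrK.
Qed.

Lemma turnS b k j : turn b k.+1 j = turn (~~ b) k (flip b j).
Proof.
rewrite /turn /flip; case: (eqVneq (odd j) b) => [eq_b|neq_b].
  by rewrite oddZD oddZ1 addbT eq_b eqxx -addrA -natr1 [(k%:R + 1)%R]addrC.
rewrite oddZD oddZN oddZ1 addbT; case: eqP => [eq_b|_]; first by rewrite (negb_inj eq_b) eqxx in neq_b.
by rewrite -natr1 opprD [(- k%:R - 1)%R]addrC addrA.
Qed.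

Lemma flipN b j : flip (~~ b) (- j)%R = (- flip b j)%R.
Proof.
by rewrite /flip oddZN; case: (odd j); case: b; rewrite /= opprD ?opprK.
Qed.

Lemma turn0_neq0 b k : 0 < k < 2 * l -> turn b k 0%R != 0%R.
Proof.
move=> /andP[k_gt0 lt_k]; suffices k_neq0 : (k%:R != 0 :> Z2l)%R.
  by rewrite /turn; case: ifP; rewrite add0r ?oppr_eq0.
by rewrite -val_eqE /= val_Zp_nat ?modn_small ?lt0n_neq0 //; lia.
Qed.

Lemma turn_full b j : turn b (2 * l) j = j.
Proof.
have -> : turn b (2 * l) j = turn b 0 j.
  suffices eq0 : ((2 * l)%:R = 0 :> Z2l)%R by rewrite /turn eq0.
  by apply/val_inj; rewrite /= val_Zp_nat ?modnn //; lia.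
by rewrite /turn subr0 addr0 if_same.
Qed.

(** A word is a stack of nontrivial dihedral elements, the top at its head, on
    alternating sides. *)
Definition avoids i w := if w is (i', _) :: _ then i' != i else true.

Fixpoint reduced w :=
  if w is (i, j) :: w' then [&& j != 0%R, avoids i w' & reduced w'] else true.

Definition push i j w := if j == 0%R then w else (i, j) :: w.

Definition pull i w : Z2l * seq letter :=
  if w is (i', j) :: w' then if i' == i then (j, w') else (0%R, w) else (0%R, w).

(** The stack w' left after removing a top element of side i determines whether
    the whole coset of w' fits in m syllables, so the truncation either keeps a
    full orbit of the dihedral group or fixes the word.  That is what preserves
    the relation of length 2 * l. *)
Definition letter_act i b w :=
  let: (j, w') := pull i w in
  if size w' < m then push i (flip b j) w' else w.

Definition word_ok w := reduced w && (size w <= m).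

Lemma pull_push i j w : avoids i w -> pull i (push i j w) = (j, w).
Proof.
rewrite /push; case: eqVneq => [->|_] /= av; last by rewrite eqxx.
by case: w av => //= [[i' j'] w] /negPf->.
Qed.

Lemma reduced_push i j w : avoids i w -> reduced w -> reduced (push i j w).
Proof. by rewrite /push; case: ifP => //= -> /= -> ->. Qed.

Lemma pullP i w : reduced w ->
  exists j w', [/\ w = push i j w', avoids i w' & reduced w'].
Proof.
case: w => [|[i' j] w] /=; first by exists 0%R, [::]; rewrite /push eqxx.
case/and3P=> nz_j av red_w; have [<-|neq_i] := eqVneq i' i.
  by exists j, w; rewrite /push (negPf nz_j).
by exists 0%R, ((i', j) :: w); rewrite /push eqxx /= nz_j av.
Qed.

Lemma size_push i j w : size w <= size (push i j w) <= (size w).+1.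
Proof. by rewrite /push; case: ifP; rewrite /= ?leqnn ?leqnSn. Qed.

Lemma letter_act_push i b j w : avoids i w ->
  letter_act i b (push i j w) =
  if size w < m then push i (flip b j) w else push i j w.
Proof. by move=> av; rewrite /letter_act pull_push. Qed.

Lemma letter_act_ok i b w : word_ok w ->
  word_ok (letter_act i b w) /\ letter_act i b (letter_act i b w) = w.
Proof.
case/andP=> red_w le_w; have [j [w' [def_w av red_w']]] := pullP i red_w.
rewrite def_w letter_act_push //; case: ifP => lt_w.
  rewrite letter_act_push // lt_w flipK; split=> //.
  rewrite /word_ok reduced_push //.
  by have /andP[_ /leq_trans->] := size_push i (flip b j) w'.
by rewrite letter_act_push // lt_w /word_ok -def_w red_w.
Qed.

(** Negating the positions of one side exchanges its two generators: j and - j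
    have the same parity, as 2 * l is even. *)
Definition neg_word i w : seq letter :=
  map (fun x => if i == x.1 then (x.1, - x.2)%R else x) w.
Definition swap_word w : seq letter := map (fun x => (~~ x.1, x.2)) w.

Lemma avoids_neg i i' w : avoids i' (neg_word i w) = avoids i' w.
Proof. by case: w => //= [[i1 j1] w]; case: ifP. Qed.

Lemma neg_push i i' j w :
  neg_word i (push i' j w) = push i' (if i == i' then - j else j)%R (neg_word i w).
Proof.
by rewrite /push (fun_if (neg_word i)) /=; case: (i == i'); rewrite ?oppr_eq0.
Qed.

Lemma neg_word_ok i w : word_ok w -> word_ok (neg_word i w) /\ neg_word i (neg_word i w) = w.
Proof.
rewrite /word_ok size_map => /andP[red_w ->]; rewrite andbT; split.
  elim: w red_w => //= [[i1 j1] w] IHw /and3P[nz_j av red_w].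
  by case: ifP => _ /=; rewrite ?oppr_eq0 nz_j avoids_neg av IHw.
rewrite /neg_word -map_comp map_id_in // => -[i1 j1] _ /=.
by case eq_i: (i == i1); rewrite /= eq_i ?opprK.
Qed.

Lemma swap_word_ok w : word_ok w -> word_ok (swap_word w) /\ swap_word (swap_word w) = w.
Proof.
rewrite /word_ok size_map => /andP[red_w ->]; rewrite andbT; split.
  elim: w red_w => //= [[i1 j1] w] IHw /and3P[-> av red_w]; rewrite IHw // andbT.
  by case: w av {IHw red_w} => //= [[i2 j2] w]; rewrite (inj_eq negb_inj).
by rewrite /swap_word -map_comp map_id_in // => -[i1 j1] _ /=; rewrite negbK.
Qed.

Lemma neg_act i i' b w : reduced w ->
  neg_word i (letter_act i' b w) = letter_act i' (b (+) (i == i')) (neg_word i w).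
Proof.
move=> red_w; have [j [w' [-> av red_w']]] := pullP i' red_w.
rewrite letter_act_push // (fun_if (neg_word i)) !neg_push.
rewrite letter_act_push ?avoids_neg // size_map.
by case: eqP => _; rewrite ?addbT ?addbF // flipN.
Qed.

Lemma swap_act i b w : reduced w ->
  swap_word (letter_act i b w) = letter_act (~~ i) b (swap_word w).
Proof.
move=> red_w; have [j [w' [-> av red_w']]] := pullP i red_w.
have swap_push j1 : swap_word (push i j1 w') = push (~~ i) j1 (swap_word w').
  by rewrite /push; case: ifP.
rewrite letter_act_push // (fun_if swap_word) !swap_push.
rewrite letter_act_push ?size_map //.
by case: (w') av => //= [[i2 j2] w2]; rewrite (inj_eq negb_inj).
Qed.

(** Bounded sequences make the type of words finite. *)
Definition point := {w : m.-bseq letter | reduced w}.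
Definition word_of (u : point) : seq letter := val (val u).

Lemma word_ofP u : word_ok (word_of u).
Proof. by rewrite /word_ok (valP u) size_bseq. Qed.

Lemma word_of_inj : injective word_of.
Proof. by move=> u v /val_inj/val_inj. Qed.

(** The default value u of insubd is never used for the maps considered, which
    send admissible words to admissible words. *)
Definition lift (f : seq letter -> seq letter) (u : point) : point :=
  insubd u (insub_bseq m (f (word_of u))).

Section WordPerm.

Variable f : seq letter -> seq letter.
Hypothesis f_ok : forall w, word_ok w -> word_ok (f w) /\ f (f w) = w.

Lemma lift_word u : word_of (lift f u) = f (word_of u).
Proof.
have [/andP[red_f le_f] _] := f_ok (word_ofP u).
have val_f : insub_bseq m (f (word_of u)) = f (word_of u) :> seq letter.
  by rewrite /insub_bseq insubdK.
by rewrite /word_of /lift insubdK // unfold_in /= val_f.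
Qed.

Lemma liftK : involutive (lift f).
Proof.
by move=> u; apply: word_of_inj; rewrite !lift_word (f_ok (word_ofP u)).2.
Qed.

Definition word_perm : {perm point} := perm (can_inj liftK).

Lemma word_permE u : word_of (word_perm u) = f (word_of u).
Proof. by rewrite permE lift_word. Qed.

Lemma word_permK : (word_perm * word_perm)%g = 1%g.
Proof. by apply/permP=> u; rewrite permM perm1 !permE liftK. Qed.

End WordPerm.

Definition letter_perm i b := word_perm (letter_act_ok i b).
Definition neg_perm i := word_perm (neg_word_ok i).
Definition swap_perm := word_perm swap_word_ok.

Lemma altword_push i b k (u : point) j w : word_of u = push i j w ->
  avoids i w -> size w < m ->
  word_of (altword letter_perm i b k u) = push i (turn b k j) w.
Proof.
move=> def_u av lt_w; elim: k b j u def_u => [|k IHk] b j u def_u.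
  by rewrite perm1 def_u /turn addr0 subr0 if_same.
rewrite /= permM turnS; apply: IHk.
by rewrite word_permE def_u letter_act_push // lt_w.
Qed.

Lemma altword_fix i b k (u : point) :
  (forall b', letter_perm i b' u = u) -> altword letter_perm i b k u = u.
Proof.
by move=> fix_u; elim: k b => [|k IHk] b; rewrite /= ?perm1 // permM fix_u IHk.
Qed.

Fixpoint stack i w (s : seq (bool * nat)) : seq letter :=
  if s is (b, k) :: s' then stack (~~ i) ((i, turn b k 0%R) :: w) s' else w.

Lemma stack_cat i w s : exists t, stack i w s = t ++ w.
Proof.
elim: s i w => [|[b k] s IHs] i w /=; first by exists [::].
have [t ->] := IHs (~~ i) ((i, turn b k 0%R) :: w).
by exists (rcons t (i, turn b k 0%R)); rewrite cat_rcons.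
Qed.

(** As in the normal form theorem: a product with room to spare writes itself on
    top of the stack. *)
Lemma syl_eval_stack i s (u : point) : proper_syl l s -> avoids i (word_of u) ->
    size (word_of u) + size s <= m ->
  word_of (syl_eval letter_perm i s u) = stack i (word_of u) s.
Proof.
elim: s i u => [|[b k] s IHs] i u /=; first by rewrite perm1.
case/andP=> k_ok s_ok av le_m; rewrite permM.
have word_v : word_of (altword letter_perm i b k u) = (i, turn b k 0%R) :: word_of u.
  rewrite (@altword_push i b k u 0%R (word_of u)) //; last by lia.
  by rewrite /push (negPf (turn0_neq0 _ k_ok)).
rewrite IHs // word_v //=; first by case: (i).
by move: le_m => /=; lia.
Qed.

Lemma syl_eval_inv (gT : finGroupType) (z : bool -> bool -> gT) i s :
    (forall i b, z i b * z i b = 1)%g -> proper_syl l s ->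
  exists s', [/\ proper_syl l s', size s' = size s &
    ((syl_eval z i s)^-1 = syl_eval z (i (+) ~~ odd (size s)) s')%g].
Proof.
move=> zK; elim: s i => [|[b k] s IHs] i /=.
  by exists [::]; rewrite invg1.
case/andP=> k_ok /(IHs (~~ i))[s' [s'_ok sz_s' eq_s']].
exists (rcons s' (b (+) ~~ odd k, k)); rewrite size_rcons sz_s'; split=> //.
  by rewrite /proper_syl all_rcons /= k_ok.
rewrite invMg eq_s' (altword_inv _ _ _ zK) -cats1 syl_eval_cat /= sz_s' mulg1.
by congr (syl_eval _ _ _ * altword _ _ _ _)%g; case: (i); case: (odd (size s)).
Qed.

(** A product s1 s2 equal to 1 makes the inverse of s1 and s2 act alike on the
    empty word.  Their first syllables lie on different sides, because the last
    syllable of s1 and the first one of s2 do, and these are the bottom letters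
    of the two stacks. *)
Lemma quad_letter : l./2 <= m -> free_quadruple letter_perm l.
Proof.
move=> le_lm.
have zK i b : (letter_perm i b * letter_perm i b = 1)%g by apply: word_permK.
split=> // [i b|i s s_ok /andP[s_gt0 le_s]].
  apply/permP=> u; rewrite perm1; apply: word_of_inj.
  have /andP[red_u _] := word_ofP u.
  have [j [w [def_u av red_w]]] := pullP i red_u.
  have [lt_w|le_w] := ltnP (size w) m.
    by rewrite (altword_push _ _ def_u) // turn_full.
  rewrite altword_fix // => b'; apply: word_of_inj.
  by rewrite word_permE def_u letter_act_push // ltnNge le_w.
apply/negP=> /eqP eval1.
have [e0 e0P] : exists u : point, word_of u = [::].
  by exists (Sub [bseq] isT).
pose q := (size s)./2.
have sz_s1 : size (take q s) = q by rewrite size_takel // /q; lia.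
have sz_s2 : size (drop q s) = uphalf (size s).
  by rewrite size_drop /q; lia.
have [s1_ok s2_ok] : proper_syl l (take q s) /\ proper_syl l (drop q s).
  by apply/andP; rewrite /proper_syl -all_cat cat_take_drop.
rewrite -(cat_take_drop q s) syl_eval_cat sz_s1 in eval1.
have [s1 [s1ok sz_s1' eq_s1]] := syl_eval_inv i zK s1_ok.
have: word_of ((syl_eval letter_perm i (take q s))^-1 e0)%g =
      word_of (syl_eval letter_perm (i (+) odd q) (drop q s) e0).
  congr (word_of (fun_of_perm _ _)).
  by apply/eqP; rewrite eq_invg_mul eval1.
rewrite eq_s1 sz_s1 !syl_eval_stack ?e0P //=; try by rewrite ?sz_s1' ?sz_s1 ?sz_s2 /q; lia.
case: s1 sz_s1' {eq_s1 s1ok} => [|[b1 k1] s1] sz_s1'.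
  case: (drop q s) sz_s2 => [|[b2 k2] s2] /=; first by lia.
  by have [t ->] := stack_cat (~~ (i (+) odd q)) [:: (i (+) odd q, turn b2 k2 0%R)] s2;
     case: t.
case: (drop q s) sz_s2 => [|[b2 k2] s2] /=; first by lia.
have [t1 ->] := stack_cat (~~ (i (+) ~~ odd q)) [:: (i (+) ~~ odd q, turn b1 k1 0%R)] s1.
have [t2 ->] := stack_cat (~~ (i (+) odd q)) [:: (i (+) odd q, turn b2 k2 0%R)] s2.
rewrite !cats1 => _ /rcons_inj[_ eqi _]; move: eqi.
by case: (i); case: (odd q).
Qed.

Lemma letter_symmetry : dihedral_symmetry letter_perm
  (fun i x => x ^ neg_perm i)%g (fun x => x ^ swap_perm)%g.
Proof.
have conjK (s : {perm point}) : (s * s = 1)%g -> involutive (fun x => x ^ s)%g.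
  by move=> sK x; rewrite -conjgM sK conjg1.
have conjP (s x y : {perm point}) : (x * s = s * y)%g -> (x ^ s = y)%g.
  by move=> eq_xs; rewrite conjgE eq_xs mulKg.
split.
- by move=> i x y; rewrite conjMg.
- by move=> i; apply/conjK/word_permK.
- move=> i i' b; apply: conjP; apply/permP=> u; rewrite !permM; apply: word_of_inj.
  by rewrite !word_permE neg_act //; case/andP: (word_ofP u).
- by move=> x y; rewrite conjMg.
- by apply/conjK/word_permK.
move=> i b; apply: conjP; apply/permP=> u; rewrite !permM; apply: word_of_inj.
by rewrite !word_permE swap_act //; case/andP: (word_ofP u).
Qed.

Lemma word_eq i w1 w2 : reduced w1 -> reduced w2 -> avoids i w1 -> avoids i w2 ->
  (forall n, nth 0%R (unzip2 w1) n = nth 0%R (unzip2 w2) n) -> w1 = w2.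
Proof.
elim: w1 w2 i => [|[i1 j1] w1 IHw] [|[i2 j2] w2] i //=.
- by move=> _ /andP[nz_j _] _ _ /(_ 0) /= eq_j; rewrite -eq_j eqxx in nz_j.
- by move=> /andP[nz_j _] _ _ _ /(_ 0) /= eq_j; rewrite eq_j eqxx in nz_j.
case/and3P=> _ av1 red1 /and3P[_ av2 red2] neq1 neq2 eq_nth.
have eq_i : i2 = i1 by case: i i1 i2 neq1 neq2 {av1 av2} => [] [] [].
rewrite eq_i in av2 *; have /= -> := eq_nth 0.
by rewrite (IHw w2 i1) // => n; have := eq_nth n.+1.
Qed.

(** A word is determined by the side of its top letter and its positions: a
    position 0 marks the end, as the letters of a reduced word are nonzero. *)
Lemma card_point : #|{: point}| <= 2 * (2 * l) ^ m.
Proof.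
pose enc (u : point) : bool * m.-tuple Z2l :=
  (head true (unzip1 (word_of u)), [tuple nth 0%R (unzip2 (word_of u)) n | n < m]).
have enc_inj : injective enc.
  move=> u v /eqP; rewrite xpair_eqE => /andP[/eqP eq_hd /eqP eq_nth].
  apply: word_of_inj.
  have {}eq_nth n : nth 0%R (unzip2 (word_of u)) n = nth 0%R (unzip2 (word_of v)) n.
    have [lt_n|le_n] := ltnP n m; last first.
      have /andP[_ le_u] := word_ofP u; have /andP[_ le_v] := word_ofP v.
      by rewrite !nth_default // size_map; apply: leq_trans le_n.
    by have := congr1 (fun s => tnth s (Ordinal lt_n)) eq_nth; rewrite !tnth_mktuple.
  have /andP[red_u _] := word_ofP u; have /andP[red_v _] := word_ofP v.
  apply: (@word_eq (~~ head true (unzip1 (word_of u)))) => //.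
    by case: (word_of u) => //= [[[] ?] ?].
  by rewrite eq_hd; case: (word_of v) => //= [[[] ?] ?].
apply: leq_trans (leq_card _ enc_inj) _.
by rewrite card_prod card_bool card_tuple card_ord modulus.
Qed.

End FreeProductAction.

(** * A large group of exponent 2 * l with three generators *)

Section LargeGroup.

Import GRing.Theory.
Local Open Scope ring_scope.

Variable l : nat.
Hypothesis l_pr : prime l.

Local Notation F := 'F_l.
Local Notation V := {ffun 'I_l.-1 -> F}.
Local Notation Q := (V * F)%type.
Local Notation X := (Q * bool)%type.
Implicit Types (q : Q) (x : X) (S T : {set Q}).

Definition origin : Q := (0, 0).

(** The map transl adds to a vector at level k, in 'F_l, the vector w k.
    Together with the shift of levels, it generates a group of exponent l as
    soon as the w k add up to 0: an element that moves the levels visits all of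
    them in l steps.  The basis vectors and the opposite of their sum satisfy
    this and span V, whence a transitive action on the l ^ l positions. *)
Definition level_vec (k : F) : V :=
  [ffun j : 'I_l.-1 => (k == j%:R)%:R - (k == l.-1%:R)%:R].

Definition shift_fun x : X := ((x.1.1, x.1.2 + 1), x.2).
Definition transl_fun x : X := ((x.1.1 + level_vec x.1.2, x.1.2), x.2).
Definition toggle_fun S x : X := (x.1, x.2 (+) (x.1 \in S)).

Lemma shift_inj : injective shift_fun.
Proof.
move=> [[f k] b] [[f' k'] b'] /eqP; rewrite !xpair_eqE /= (inj_eq (addIr _)).
by case/andP=> /andP[/eqP-> /eqP->] /eqP->.
Qed.

Lemma transl_inj : injective transl_fun.
Proof.
move=> [[f k] b] [[f' k'] b'] /eqP; rewrite !xpair_eqE /=.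
by case/andP=> /andP[eq_f /eqP eq_k] /eqP->; move: eq_f; rewrite eq_k => /eqP/addIr->.
Qed.

Lemma toggleK S : involutive (toggle_fun S).
Proof. by move=> [q b]; rewrite /toggle_fun /= -addbA addbb addbF. Qed.

Definition shift : {perm X} := perm shift_inj.
Definition transl : {perm X} := perm transl_inj.
Definition toggle S : {perm X} := perm (can_inj (toggleK S)).

Definition lamp_gens := [tuple shift; transl; toggle [set origin]].
Definition lamp_group := <<[set x in lamp_gens]>>%G.

Lemma shift_lamp : shift \in lamp_group.
Proof. by apply: mem_gen; rewrite !inE eqxx. Qed.

Lemma transl_lamp : transl \in lamp_group.
Proof. by apply: mem_gen; rewrite !inE eqxx orbT. Qed.

Lemma toggle0_lamp : toggle [set origin] \in lamp_group.
Proof. by apply: mem_gen; rewrite !inE eqxx !orbT. Qed.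

Lemma sum_level_vec : \sum_k level_vec k = 0.
Proof.
apply/ffunP=> j; rewrite sum_ffunE !ffunE.
under eq_bigr do rewrite ffunE.
have sum1 (a : F) : \sum_k ((k == a)%:R : F) = 1.
  rewrite (bigD1 a) //= eqxx big1 ?addr0 // => k /negPf-> //.
by rewrite sumrB !sum1 subrr.
Qed.

Lemma natF_eq j k : (j < l)%N -> (k < l)%N -> (j%:R == k%:R :> F) = (j == k).
Proof.
move=> lt_j lt_k; have valF n : (n < l)%N -> nat_of_ord (n%:R : F) = n.
  by move=> lt_n; rewrite val_Fp_nat // modn_small.
by rewrite -[RHS](congr2 (fun a b => a == b) (valF j lt_j) (valF k lt_k)).
Qed.

Lemma charF (a : F) : a *+ l = 0.
Proof. by rewrite -mulr_natr pchar_Fp_0 // mulr0. Qed.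

Lemma charV (w : V) : w *+ l = 0.
Proof. by apply/ffunP=> j; rewrite ffunMnE charF ffunE. Qed.

(** For i nonzero the progression runs through 'F_l once; for i = 0 the sum is
    l times a single vector. *)
Lemma sum_arith (u : F -> V) (k i : F) : \sum_k u k = 0 ->
  \sum_(j < l) u (k + i *+ j) = 0.
Proof.
move=> sum_u; have [->|nz_i] := eqVneq i 0.
  under eq_bigr do rewrite mul0rn addr0.
  by rewrite sumr_const card_ord; apply: charV.
have h_inj : injective (fun j : 'I_l => k + i *+ j).
  move=> j j' /addrI; rewrite -(mulr_natr i j) -(mulr_natr i j') => /(mulfI nz_i) /eqP.
  by rewrite natF_eq // => /eqP/val_inj.
have h_bij : bijective (fun j : 'I_l => k + i *+ j).
  by apply: inj_card_bij; rewrite // (card_Fp l_pr) card_ord.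
by rewrite -[RHS]sum_u [RHS](reindex _ (onW_bij _ h_bij)).
Qed.

(** The general form of the elements: a vector u k above level k with total sum
    0, a shift of the levels, and a change of lamps. *)
Lemma lamp_form (h : {perm X}) : h \in lamp_group ->
  exists u : F -> V, exists i : F, exists2 c : Q -> bool, \sum_k u k = 0 &
    forall x, h x = ((x.1.1 + u x.1.2, x.1.2 + i), x.2 (+) c x.1).
Proof.
move: h; apply: (@gen_ind _ [set x in lamp_gens]) => [|h a [u [i [c sum_u hE]]]].
  exists (fun=> 0), 0, (fun=> false); first by rewrite big1.
  by move=> [[f k] b]; rewrite perm1 !addr0 addbF.
rewrite !inE => /or3P[]/eqP->.
- by exists u, (i + 1), c => // x; rewrite permM hE permE /shift_fun /= addrA.
- exists (fun k => u k + level_vec (k + i)), i, c.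
    rewrite big_split /= sum_u add0r -[RHS]sum_level_vec.
    by rewrite [RHS](reindex_inj (addIr i)).
  by move=> x; rewrite permM hE permE /transl_fun /= addrA.
exists u, i, (fun q => c q (+) ((q.1 + u q.2, q.2 + i) == origin)) => // x.
by rewrite permM hE permE /toggle_fun /= inE addbA.
Qed.

(** The power l acts trivially on positions, hence only changes lamps, and its
    square is 1. *)
Lemma lamp_exp (h : {perm X}) : h \in lamp_group -> (h ^+ (2 * l) = 1)%g.
Proof.
move=> hH; have [u [i [c sum_u hE]]] := lamp_form hH.
have hX n x : ((h ^+ n)%g x).1 =
    (x.1.1 + \sum_(j < n) u (x.1.2 + i *+ j), x.1.2 + i *+ n).
  elim: n => [|n IHn]; first by rewrite expg0 perm1 big_ord0 !addr0 -surjective_pairing.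
  by rewrite expgSr permM hE /= IHn /= big_ord_recr /= addrA mulrSr addrA.
have hl x : ((h ^+ l)%g x).1 = x.1.
  by rewrite hX sum_arith // addr0 charF addr0 -surjective_pairing.
have [v [i' [d _ hlE]]] := lamp_form (groupX l hH).
apply/permP=> x; rewrite mulnC expgM expgS expg1 permM perm1.
rewrite [LHS]surjective_pairing !hl [in X in (_, X)]hlE /= hl hlE /= -addbA addbb addbF.
by rewrite -surjective_pairing.
Qed.

Lemma toggleM S T : (toggle S * toggle T)%g = toggle ((S :\: T) :|: (T :\: S)).
Proof.
apply/permP=> -[q b]; rewrite permM !permE /toggle_fun /= !inE.
by case: (q \in S); case: (q \in T); case: b.
Qed.

Lemma toggleJ S (h : {perm X}) (h1 : Q -> Q) : injective h1 ->
  (forall x, h x = (h1 x.1, x.2)) -> (toggle S ^ h)%g = toggle (h1 @: S).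
Proof.
move=> h1_inj hE; apply/permP=> x; rewrite -[x](permKV h) permJ.
move: ((h^-1)%g x) => {x} [q b]; rewrite !permE /toggle_fun /= !hE /=.
by rewrite mem_imset.
Qed.

(** Conjugation moves the lamp toggled by the third generator to every position,
    as the first two act transitively on positions. *)
Lemma toggle1_lamp q : toggle [set q] \in lamp_group.
Proof.
have shiftP f k : toggle [set (f, k)] \in lamp_group ->
    toggle [set (f, k + 1)] \in lamp_group.
  move=> tH; have := groupJ tH shift_lamp.
  rewrite (@toggleJ _ _ (fun q => (q.1, q.2 + 1))) ?imset_set1 //.
    move=> [f1 k1] [f2 k2] /eqP; rewrite xpair_eqE /= (inj_eq (addIr _)).
    by case/andP=> /eqP-> /eqP->.
  by move=> [[? ?] ?]; rewrite permE.
have translP f k : toggle [set (f, k)] \in lamp_group ->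
    toggle [set (f + level_vec k, k)] \in lamp_group.
  move=> tH; have := groupJ tH transl_lamp.
  rewrite (@toggleJ _ _ (fun q => (q.1 + level_vec q.2, q.2))) ?imset_set1 //.
    move=> [f1 k1] [f2 k2] /eqP; rewrite xpair_eqE /= => /andP[/eqP + /eqP eq_k].
    by rewrite eq_k => /addIr->.
  by move=> [[? ?] ?]; rewrite permE.
have anyk f k k' : toggle [set (f, k)] \in lamp_group ->
    toggle [set (f, k')] \in lamp_group.
  move=> tH; rewrite -(subrK k k') -[k' - k]natr_Zp addrC.
  by elim: (val _) => [|n IHn]; rewrite ?addr0 // mulrSr addrA; apply: shiftP.
have addv f k k' (n : nat) : toggle [set (f, k)] \in lamp_group ->
    toggle [set (f + level_vec k' *+ n, k)] \in lamp_group.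
  move=> tH; elim: n => [|n IHn]; first by rewrite addr0.
  by rewrite mulrSr addrA; apply: anyk (translP _ _ (anyk _ _ _ IHn)).
have span (f : V) : f = \sum_(j : 'I_l.-1) level_vec (j : nat)%:R *+ f j.
  have l_gt0 := prime_gt0 l_pr.
  apply/ffunP=> i; rewrite sum_ffunE (bigD1 i) //= big1 => [|j neq_ji].
    rewrite ffunMnE ffunE eqxx natF_eq; try by case: (i) => ? /=; lia.
    have -> : (i == l.-1 :> nat) = false by case: (i) => ? /=; lia.
    by rewrite subr0 addr0 natr_Zp.
  rewrite ffunMnE ffunE !natF_eq; try by case: (i) => ? /=; case: (j) => ? /=; lia.
  rewrite -val_eqE in neq_ji; rewrite (negPf neq_ji).
  have -> : (j == l.-1 :> nat) = false by case: (j) => ? /=; lia.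
  by rewrite subrr mul0rn.
case: q => f k; rewrite [f]span -[X in (X, _)]add0r.
elim/big_rec: _ => [|j g _ IHg]; first by rewrite addr0; apply: anyk toggle0_lamp.
by rewrite addrCA addrC; apply: addv.
Qed.

Lemma toggle_lamp S : toggle S \in lamp_group.
Proof.
have toggle0 : toggle set0 = 1%g.
  by apply/permP=> -[q b]; rewrite perm1 permE /toggle_fun inE addbF.
have [n] := ubnP #|S|; elim: n S => // n IHn S le_S.
have [->|[q qS]] := set_0Vmem S; first by rewrite toggle0 group1.
have -> : S = ([set q] :\: (S :\ q)) :|: ((S :\ q) :\: [set q]).
  by apply/setP=> p; rewrite !inE; case: eqVneq => [->|_]; rewrite ?qS //=; case: (p \in S).
rewrite -toggleM groupM ?toggle1_lamp // IHn //.
by rewrite (cardsD1 q) qS in le_S.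
Qed.

Lemma card_lamp_group : (2 ^ (l ^ l) <= #|lamp_group|)%N.
Proof.
have toggle_inj : injective toggle.
  move=> S T eqST; apply/setP=> q.
  by have /(congr1 snd) := congr1 (fun h : {perm X} => h (q, false)) eqST; rewrite !permE.
have cardQ : #|{: Q}| = (l ^ l)%N.
  rewrite card_prod card_ffun card_Fp // card_ord -expnSr.
  by rewrite prednK ?prime_gt0.
rewrite -cardQ -cardsT -card_powerset -(card_imset _ toggle_inj).
by apply/subset_leq_card/subsetP=> _ /imsetP[S _ ->]; apply: toggle_lamp.
Qed.

Hypothesis l_odd : odd l.

Lemma exponent_lamp_group : exponent lamp_group = (2 * l)%N.
Proof.
apply/eqP; rewrite eqn_dvd; apply/andP; split.
  by apply/exponentP=> h /lamp_exp.
rewrite Gauss_dvd ?coprime2n //; apply/andP; split.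
  rewrite dvdn2; apply/negP=> e_odd.
  have := expg_exponent toggle0_lamp.
  have tt : (toggle [set origin] ^+ 2 = 1)%g.
    by apply/permP=> x; rewrite expgS expg1 permM perm1 !permE toggleK.
  rewrite -[exponent _]odd_double_half e_odd add1n expgS -mul2n expgM tt expg1n mulg1.
  move/(congr1 (fun h : {perm X} => (h (origin, false)).2)); rewrite perm1 permE.
  by rewrite /toggle_fun /= inE eqxx.
have shX n x : (((shift ^+ n)%g x).1.2 : F) = x.1.2 + n%:R.
  elim: n => [|n IHn]; first by rewrite expg0 perm1 addr0.
  by rewrite expgSr permM permE /= IHn mulrSr addrA.
have := expg_exponent shift_lamp.
move/(congr1 (fun h : {perm X} => (h (origin, false)).1.2)); rewrite perm1 shX /= add0r.
by move/(congr1 val) => /=; rewrite val_Fp_nat // => /eqP.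
Qed.

Lemma lamp_order : finite_group_order 3 (2 * l) #|lamp_group|.
Proof.
exists {perm X}, lamp_group; split=> //; last exact: exponent_lamp_group.
by exists lamp_gens.
Qed.

End LargeGroup.

(** * The case of the prime 2 *)

Section Klein.

Local Notation D := ('Z_2 * 'Z_2)%type.

Definition klein_gen (b : bool) : D := if b then (Zp0, Zp1) else (Zp1, Zp0).

(** In a direct product of two dihedral groups, the two sides meet
    trivially, so that no relation has one or two syllables; and 2 * l./2 = 2
    for l = 2. *)
Definition klein_quad (i b : bool) : D * D :=
  if i then (1%g, klein_gen b) else (klein_gen b, 1%g).

Definition klein_flip (i : bool) (x : D * D) : D * D :=
  if i then (x.1, (x.2.2, x.2.1)) else ((x.1.2, x.1.1), x.2).

Definition klein_swap (x : D * D) : D * D := (x.2, x.1).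

Lemma klein_free : free_quadruple klein_quad 2.
Proof.
split=> [i b|i b|i s]; first by apply/eqP; case: i; case: b.
  by apply/eqP; case: i; case: b.
have lt4 k : 0 < k < 2 * 2 -> k \in [:: 1; 2; 3] by case: k => [|[|[|[|k]]]].
case: s => [|[b k] [|[b' k'] [|x s]]] s_ok sz_s //.
  move: s_ok; rewrite /proper_syl /= andbT mulg1 => /lt4.
  by rewrite !inE => /or3P[]/eqP->; case: i; case: (b).
move: s_ok; rewrite /proper_syl /= andbT mulg1 => /andP[/lt4 + /lt4].
by rewrite !inE => /or3P[]/eqP-> /or3P[]/eqP->; case: i; case: (b); case: (b').
Qed.

Lemma klein_symmetry : dihedral_symmetry klein_quad klein_flip klein_swap.
Proof.
split=> [i x y|i [[? ?] [? ?]]|i j b|x y|[? ?]|i b] //; try by case: i.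
by case: i; case: j; case: b.
Qed.

Lemma cyclic4_order : finite_group_order 3 4 4.
Proof.
have ZpT : [set: 'Z_4] = <[Zp1 : 'Z_4]>%g by rewrite -Zp_cycle.
exists 'Z_4, [set: 'Z_4]%G; split; last by rewrite cardsT card_ord.
  exists [tuple Zp1; Zp1; Zp1]; rewrite /= ZpT; congr <<_>>%g.
  by apply/setP=> x; rewrite !inE !orbb.
by rewrite /= exponent_cyclic /= ?cardsT ?card_ord // ZpT cycle_cyclic.
Qed.

End Klein.

(** * Comparison of orders *)

Lemma leq_expl e m n : m <= n -> m ^ e <= n ^ e.
Proof. by case: e => // e le_mn; rewrite leq_exp2r. Qed.

Lemma leq_exp_half m : 1 < m -> 2 ^ m.+1 * m.+1 ^ 2 <= (2 * m).+1 ^ m.+1.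
Proof.
case: m => [|[|m]] // _; rewrite -[m.+3]addn3 !expnD.
have le1 : 2 ^ m <= (2 * m.+2).+1 ^ m by apply: leq_expl; lia.
have le2 : 2 ^ 3 * (m + 3) ^ 2 <= (2 * m.+2).+1 ^ 3 by rewrite !expnS !expn0; nia.
by rewrite -mulnA; apply: leq_mul.
Qed.

Lemma fact_leq_exp n : n`! <= n ^ n.
Proof.
elim: n => // n IHn; rewrite factS expnS leq_mul2l /=.
by apply: leq_trans IHn _; apply: leq_expl.
Qed.

(** With n = 2 * (2 * l) ^ m and l = 2 * m + 1 >= 5, the bounds n! <= n ^ n and
    n <= 2 ^ (m + 1) ^ 2 reduce the claim to n * (m + 1) ^ 2 <= l ^ l, which
    [leq_exp_half] gives after cancelling l ^ m.  These bounds are too weak for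
    l = 3, where the claim is 12! <= 2 ^ 30. *)
Lemma point_bound l : prime l -> odd l -> (2 * (2 * l) ^ l./2)`! <= 8 * 2 ^ (l ^ l).
Proof.
move=> l_pr l_odd; have l_gt1 := prime_gt1 l_pr.
have def_l : l = (2 * l./2).+1 by lia.
have [le_m|lt_m] := leqP l./2 1.
  have -> : l = 3 by lia.
  have -> : 2 * (2 * 3) ^ 3./2 = 12 by [].
  (* Grouping the factors keeps the numbers small enough for unary arithmetic. *)
  have -> : 12`! = (12 * 11 * 10 * 9) * (8 * 7 * 6 * 5) * (4 * 3 * 2).
    by rewrite !factS fact0; lia.
  have -> : 8 * 2 ^ (3 ^ 3) = 2 ^ 14 * 2 ^ 11 * 2 ^ 5.
    by rewrite -[8]/(2 ^ 3) -!expnD; congr (2 ^ _).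
  by apply: leq_mul; first apply: leq_mul; lia.
set m := l./2 in def_l lt_m *; set n := 2 * _.
have def_n : n = 2 ^ m.+1 * l ^ m by rewrite /n expnMn mulnA -expnS.
have le_n : n <= 2 ^ (m.+1 * m.+1).
  rewrite def_n mulnS expnD leq_mul2l expnM leq_expl ?orbT // def_l expnS.
  by have := ltn_expl m (ltnSn 1); lia.
apply: leq_trans (fact_leq_exp n) _.
apply: leq_trans (leq_expl n le_n) _.
apply: leq_trans (leq_pmull _ (isT : 0 < 8)).
rewrite -expnM leq_exp2l // mulnn def_n mulnA [_ ^ 2 * _]mulnC.
have -> : l ^ l = l ^ m.+1 * l ^ m by rewrite -expnD {2}def_l; congr (_ ^ _); lia.
by rewrite leq_mul2r [X in _ <= X ^ _]def_l leq_exp_half ?orbT.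
Qed.

(** * The theorem *)

Lemma card_permT (T : finType) : #|{perm T}| = #|T|`!.
Proof.
rewrite -[in RHS]cardsT -card_perm; apply: eq_card => s.
by apply/esym/subsetP=> x; rewrite inE.
Qed.

Theorem corollary4 (l : nat) (hl : prime l) :
  exists Gamma : sgraph,
    [/\ connected_graph Gamma, vertex_transitive Gamma, three_valent Gamma
      & flexible Gamma] /\
    has_girth Gamma (2 * l) /\
    (forall N : nat, largest_order 3 (2 * l) N -> #|Gamma| <= 16 * N).
Proof.
have [l_odd|l_even] := boolP (odd l).
  have [Gamma [props girth card_Gamma]] := flexible_graph_of_quadruple
    (prime_gt1 hl) (quad_letter (prime_gt1 hl) (leqnn _))
    (letter_symmetry (l./2) (prime_gt1 hl)).
  exists Gamma; split=> //; split=> // N [_ /(_ _ (lamp_order hl l_odd)) le_N].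
  apply: leq_trans card_Gamma _.
  rewrite (_ : 16 * N = 2 * (8 * N)) ?leq_mul2l /=; last by lia.
  rewrite card_permT.
  apply: leq_trans (leq_fact (card_point l./2 (prime_gt1 hl))) _.
  apply: leq_trans (point_bound hl l_odd) _.
  by rewrite leq_mul2l /=; apply: leq_trans (card_lamp_group hl) le_N.
have {l_even} -> : l = 2 by case: (even_prime hl) l_even => // ->.
have [Gamma [props girth card_Gamma]] :=
  flexible_graph_of_quadruple (isT : 1 < 2) klein_free klein_symmetry.
exists Gamma; split=> //; split=> // N [_ /(_ _ cyclic4_order) le_N].
apply: leq_trans card_Gamma _.
apply: leq_trans (_ : 16 * 4 <= _); first by rewrite !card_prod !card_ord.
by rewrite leq_mul2l.
Qed.
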